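(* Let $X$ be a locally connected completely regular space such that no (connected) component of $X$ is compact. (1) Let $P$ be a non-empty compact subspace of $\beta X\setminus X$ such that $P\cap\mathrm{cl}_{\beta X}C\neq\emptyset$ for every component $C$ of $X$. Let $T$ be the quotient space obtained from $\beta X$ by contracting $P$ to a point $p$, and let $Y=X\cup\{p\}$, considered as a subspace of $T$. Then $Y$ is a completely regular one-point connectification of $X$. (2) Conversely, every completely regular one-point connectification of $X$ is obtained in this way: if $Y=X\cup\{p\}$ is a completely regular one-point connectification of $X$, then there is a non-empty compact subspace $P$ of $\beta X\setminus X$ which intersects $\mathrm{cl}_{\beta X}C$ for every component $C$ of $X$, such that $Y$ is the subspace $X\cup\{p\}$ of the quotient space obtained from $\beta X$ by contracting $P$ to the point $p$ (up to a homeomorphism fixing each point of $X$).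
   Context: Completely regular means completely regular and Hausdorff (i.e. Tychonoff). A space $X$ is locally connected if for every $x\in X$, every neighborhood of $x$ in $X$ contains a connected neighborhood of $x$ in $X$. A space $Y$ is an extension of a space $X$ if $Y$ contains $X$ as a dense subspace; it is a one-point extension if moreover $Y\setminus X$ is a singleton. A one-point connectification of $X$ is a one-point extension of $X$ that is connected. $\beta X$ denotes the Stone--Čech compactification of $X$, regarded as containing $X$ as a dense subspace. When $P\subseteq\beta X\setminus X$ is contracted to a point $p$, each point of $X$ is identified with its image in the quotient space. *)

(* Defs.v *)
From HB Require Import structures.
From mathcomp Require Import all_boot all_order all_algebra generic_quotient.
From mathcomp Require Import all_classical reals topology normedtype.
Set Implicit Arguments.
Unset Strict Implicit.
Unset Printing Implicit Defensive.

Import Order.TTheory GRing.Theory Num.Theory.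
Import numFieldNormedType.Exports.

Local Open Scope classical_set_scope.
Local Open Scope ring_scope.
Local Open Scope quotient_scope.

Definition tychonoff_space (X : topologicalType) :=
  completely_regular_space X /\ hausdorff_space X.

Definition locally_connected (X : topologicalType) :=
  forall (x : X) (U : set X), nbhs x U ->
    exists V : set X, [/\ nbhs x V, connected V & V `<=` U].

Definition component (X : topologicalType) (C : set X) :=
  exists x : X, C = connected_component [set: X] x.

Definition embedding (X Y : topologicalType) (e : X -> Y) :=
  injective e /\
  forall A : set X, open A <-> exists2 V : set Y, open V & A = e @^-1` V.

(* X is contained in an extension Y through the embedding e. *)
Definition extension (X Y : topologicalType) (e : X -> Y) :=
  embedding e /\ dense (range e).

Definition one_point_extension (X Y : topologicalType) (e : X -> Y) :=
  extension e /\ exists p : Y, ~` range e = [set p].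

Definition one_point_connectification (X Y : topologicalType) (e : X -> Y) :=
  one_point_extension e /\ connected [set: Y].

Definition homeomorphism (Y Z : topologicalType) (h : Y -> Z) :=
  continuous h /\
  exists g : Z -> Y, [/\ continuous g, cancel h g & cancel g h].

(* b : X -> B is a model of the inclusion of X in its Stone-Cech
   compactification: these properties determine B up to a homeomorphism
   compatible with b, and stone_cech_exists below provides such a B. *)
Definition stone_cech (X B : topologicalType) (b : X -> B) :=
  [/\ compact [set: B], hausdorff_space B, extension b &
      forall (K : topologicalType) (f : X -> K),
        compact [set: K] -> hausdorff_space K -> continuous f ->
        exists2 F : B -> K, continuous F & forall x, F (b x) = f x].

Section collapsed.
Context {T : topologicalType} (P : set T).

Let collapse_rel (x y : T) := (x == y) || ((x \in P) && (y \in P)).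

Let collapse_refl : reflexive collapse_rel.
Proof. by move=> x; rewrite /collapse_rel eqxx. Qed.

Let collapse_sym : symmetric collapse_rel.
Proof. by move=> x y; rewrite /collapse_rel eq_sym andbC. Qed.

Let collapse_trans : transitive collapse_rel.
Proof.
move=> y x z; rewrite /collapse_rel => /predU1P[-> //|/andP[xP yP]].
by move=> /predU1P[<-|/andP[_ zP]]; rewrite xP ?yP ?zP orbT.
Qed.

Definition collapse_equiv :=
  EquivRel _ collapse_refl collapse_sym collapse_trans.

(* The quotient of T in which the points of P are identified. *)
Definition collapsed := {eq_quot collapse_equiv}.

HB.instance Definition _ :=
  Topological.copy collapsed (quotient_topology collapsed).
HB.instance Definition _ := Quotient.on collapsed.

Definition collapse (x : T) : collapsed := \pi_collapsed x.

Lemma collapseP (x y : T) : collapse x = collapse y <-> x = y \/ P x /\ P y.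
Proof.
split=> [/eqquotP /predU1P[->|]|xy]; first by left.
  by move=> /andP[/set_mem Px /set_mem Py]; right.
apply/eqquotP; rewrite /= /collapse_rel.
by case: xy => [->|[/mem_set -> /mem_set ->]]; rewrite ?eqxx ?orbT.
Qed.

Lemma collapse_open (U : set collapsed) : open U <-> open (collapse @^-1` U).
Proof. by []. Qed.

End collapsed.

Section adjoined.
Context {X B : topologicalType} (b : X -> B) (P : set B) (p : collapsed P).

Definition adjoined : set (collapsed P) :=
  [set collapse P (b x) | x in [set: X]] `|` [set p].

Lemma adjoined_in (x : X) : collapse P (b x) \in adjoined.
Proof. by apply/mem_set; left; exists x. Qed.

(* Used as a type, the set adjoined carries the subspace topology. *)
Definition to_adjoined (x : X) : adjoined :=
  exist (fun t => t \in adjoined) (collapse P (b x)) (adjoined_in x).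

End adjoined.

Lemma compact_set_type (T : topologicalType) (K : set T) :
  compact K -> compact [set: K].
Proof.
move=> cK F FF _.
have [|p [Kp clp]] := cK (set_val @ F).
  by apply: (@filterS _ F _ setT) => [x _|]; [exact: set_valP|exact: filterT].
exists (exist _ p (mem_set Kp)); split => // A U FA [_ [[W oW <-] /= Wp WU]].
have nW := open_nbhs_nbhs (conj oW Wp).
have [|y [[x Ax <-] Wx]] := clp (set_val @` A) W _ nW.
  by apply: (@filterS _ F _ A) => // x Ax; exists x.
by exists x; split => //; exact: WU.
Qed.

Lemma hausdorff_set_type (T : topologicalType) (K : set T) :
  hausdorff_space T -> hausdorff_space K.
Proof.
move=> hT p q clpq; apply: val_inj; apply: hT => A U.
rewrite !nbhsE => -[A' [oA' A'p] A'A] [U' [oU' U'q] U'U].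
have [||z [/= Az Uz]] := clpq (set_val @^-1` A') (set_val @^-1` U').
- by exists (set_val @^-1` A'); split => //; exists A'.
- by exists (set_val @^-1` U'); split => //; exists U'.
by exists (set_val z); split; [exact: A'A|exact: U'U].
Qed.

Section stone_cech_exists.
Context (R : realType) (X : topologicalType) (tX : tychonoff_space X).

Let I := {classic {f : X -> R | continuous f /\ range f `<=` `[0, 1]}}.
Let f_ (i : I) : X -> R := proj1_sig i.
Let PU := prod_topology (fun _ : I => R : topologicalType).
Let j : X -> PU := @join_product I X (fun=> R) f_.
Let K : set PU := closure (range j).

Let f_cts i : continuous (f_ i). Proof. by case: i => f []. Qed.

Let sepf : @separate_points_from_closed I X (fun=> R) f_.
Proof.
move=> U x clU Ux; have [crX _] := tX.
have /(@uniform_separatorP _ R)[f [cf f01 f0 f1]] := crX x U clU Ux.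
exists (exist _ f (conj cf f01)); rewrite /f_ /= => cl.
have fx0 : f x = 0 by apply: f0; exists x.
move: cl; rewrite fx0 => /(_ _ (nbhsx_ballx 0 1 ltr01)) [y [[z Uz <-]]].
have -> : f z = 1 by apply: f1; exists z.
by rewrite /ball /= sub0r normrN normr1 ltxx.
Qed.

Let b (x : X) : K := exist _ (j x) (mem_set (subset_closure (imageT j x))).

Let hPU : hausdorff_space PU.
Proof. by apply: hausdorff_product => i; exact: norm_hausdorff. Qed.

Let cK : compact K.
Proof.
have cC : compact [set f : PU | forall i : I, `[0, 1]%classic (f i : R)].
  have := @tychonoff I (fun=> R : topologicalType) (fun=> `[0, 1]%classic)
    (fun=> @segment_compact R 0 1).
  exact.
apply: (subclosed_compact _ cC); first exact: closed_closure.
have /closure_id -> := compact_closed hPU cC.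
by apply: closureS => _ [x _ <-] [f [cf f01]] /=; apply: f01; exists x.
Qed.

Let b_ext : extension b.
Proof.
have [crX hX] := tX.
have jinj : set_inj setT j := join_product_inj sepf (hausdorff_accessible hX).
split; last first.
  move=> O [z Oz] [W oW WO].
  have clz : K (set_val z) by exact: set_valP.
  have Wz : W (set_val z) by have : (set_val @^-1` W) z by rewrite WO.
  have [_ [[x _ <-] Wx]] := clz W (open_nbhs_nbhs (conj oW Wz)).
  by exists (b x); split; [rewrite -WO|exists x].
split.
  by move=> x y /(congr1 (@set_val _ _)) /= /jinj; apply; rewrite inE.
move=> A; rewrite (join_product_initial sepf f_cts jinj); split.
  by move=> [V oV <-]; exists (set_val @^-1` V) => //; exists V.
by move=> [_ [V oV <-] ->]; exists V.
Qed.

Let G (q : K) := filter_from (nbhs q) (fun V => b @^-1` V).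

Let G_proper q : ProperFilter (G q).
Proof.
apply: filter_from_proper.
  apply: filter_from_filter; first by exists setT; exact: filterT.
  by move=> U V qU qV; exists (U `&` V) => //; exact: filterI.
move=> V; rewrite nbhsE => -[U [oU Uq] UV].
have [y [Uy [x _ xy]]] := (b_ext.2 U (ex_intro _ q Uq) oU).
by exists x; apply: UV; rewrite xy.
Qed.

Let b_univ (C : topologicalType) (f : X -> C) :
  compact [set: C] -> hausdorff_space C -> continuous f ->
  exists2 F : K -> C, continuous F & forall x, F (b x) = f x.
Proof.
move=> cC hC cf.
have nC : normal_space C by exact: compact_normal.
have lim q : exists c : C, f @ G q --> c.
  have [c [_ cc]] : [set: C] `&` cluster (f @ G q) !=set0.
    apply: cC; first exact: fmap_proper_filter.
    by exists setT => //; exact: filterT.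
  exists c; apply: (compact_cluster_set1 hC cC).
  - exact: filterT.
  - exact: fmap_proper_filter.
  - by exists setT => //; exact: filterT.
  apply/seteqP; split => [c' cc'|_ ->//] /=; apply: contrapT => cc'E.
  have crC : completely_regular_space C.
    by apply: (@normal_completely_regular R) => //; exact: hausdorff_accessible.
  have /(@uniform_separatorP _ R)[h [ch h01 h0 h1]] :
      uniform_separator [set c] [set c'].
    apply: crC; last by move=> /= cE; apply: cc'E.
    exact/accessible_closed_set1/hausdorff_accessible.
  have hfP : continuous (h \o f) /\ range (h \o f) `<=` `[0, 1].
    split; first by move=> x; apply: continuous_comp; [exact: cf|exact: ch].
    by move=> _ [x _ <-]; apply: h01; exists (f x).
  pose i : I := exist _ (h \o f) hfP.
  have cvgi : h \o f @ G q --> (set_val q : PU) i.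
    move=> /= U /= qU.
    exists (set_val @^-1` ((fun g : PU => g i) @^-1` U)) => //.
    apply: (@initial_continuous K PU set_val q).
    exact: (@proj_continuous I (fun=> R) i (set_val q) U qU).
  have key d : cluster (f @ G q) d -> h d = (set_val q : PU) i.
    move=> cd; apply: (@norm_hausdorff _ R) => U V hU iV.
    have [y [Vy Uy]] := cd (h @^-1` V) (h @^-1` U) (cvgi _ iV) (ch _ _ hU).
    by exists (h y).
  have := key _ cc; rewrite -(key _ cc').
  have -> : h c = 0 by apply: h0; exists c.
  have -> : h c' = 1 by apply: h1; exists c'.
  by move/esym/eqP; rewrite oner_eq0.
have [F FP] := choice lim; exists F.
  move=> q W FW.
  have [W' FW' W'W] := @compact_regular C (F q) setT hC cC filterT W FW.
  have [V qV VW'] := FP q W' FW'.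
  have [V' [oV' V'q] V'V] : exists2 V', open_nbhs q V' & V' `<=` V.
    by move: (qV); rewrite {1}nbhsE.
  suff : nbhs q (F @^-1` W) by [].
  rewrite nbhsE; exists V' => // r V'r /=; apply: W'W => U /FP fU.
  have fW' : (f @ G r) W'.
    by exists V' => //; [exact: open_nbhs_nbhs|move=> x /= /V'V; exact: VW'].
  have [x [W'x Ux]] : exists x, (f @^-1` W' `&` f @^-1` U) x.
    have GW : G r (f @^-1` W') := fW'.
    have GU : G r (f @^-1` U) := fU.
    have GWU := @filterI _ _ (G_proper r) _ _ GW GU.
    exact: (@filter_ex _ _ (G_proper r) _ GWU).
  by exists (f x).
move=> x; have fGP := fmap_proper_filter f (G_proper (b x)).
apply: (@cvg_unique _ hC _ fGP); first exact: FP.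
move=> U /cf; rewrite nbhs_simpl /= nbhsE => -[V [oV Vx] VU].
have [[_ bE] _] := b_ext; have [W oW VE] := (bE V).1 oV.
exists W; first by apply: open_nbhs_nbhs; split=> //; move: Vx; rewrite VE.
by rewrite -VE => y /VU.
Qed.

Lemma stone_cech_exists :
  exists (B : topologicalType) (b : X -> B), stone_cech b.
Proof.
exists (K : topologicalType), b; split=> //.
- exact: compact_set_type.
- exact: hausdorff_set_type.
Qed.
End stone_cech_exists.

(* Main.v *)
Require Import Defs.
From mathcomp Require Import all_boot all_classical topology normedtype.
From mathcomp Require Import generic_quotient reals Rstruct.
From Stdlib Require Import Rdefinitions.
Set Implicit Arguments.
Unset Strict Implicit.
Unset Printing Implicit Defensive.

Import numFieldNormedType.Exports.

Local Open Scope classical_set_scope.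

(* Write [T] for the quotient of [B] by [P]: the quotient map is closed, so [T]
   is compact Hausdorff and the adjoined space is completely regular as a
   subspace of it. It is connected since the closure of each component of [X]
   in it is connected and contains [p].
   Conversely, let [K] be a compactification of [Y] and let [F : B -> K] extend
   the inclusion of [X]; take [P := F^-1(p)]. A component of [X] is open in [Y]
   and closed in [X], so by connectedness of [Y] its closure in [Y] contains
   [p]; hence [P] meets its closure in [B]. As [F] maps no point outside [X]
   into [X], the induced map [T -> K] is injective on the adjoined space, and
   its image there is [Y]; the topologies agree because [F] is closed. *)

(** * Embeddings, complete regularity and continuous images *)

Lemma embedding_continuous (X Y : topologicalType) (e : X -> Y) :
  embedding e -> continuous e.
Proof. by move=> [_ eE]; apply/continuousP => V oV; apply/eE; exists V. Qed.

Lemma embedding_comp (X Y Z : topologicalType) (e : X -> Y) (g : Y -> Z) :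
  embedding e -> embedding g -> embedding (g \o e).
Proof.
move=> [ei eE] [gi gE]; split; first exact: inj_comp.
move=> A; split=> [/eE[V /gE[W oW ->] ->]|[W oW ->]]; first by exists W.
by apply/eE; exists (g @^-1` W) => //; apply/gE; exists W.
Qed.

Lemma set_val_embedding (T : topologicalType) (K : set T) :
  embedding (set_val : K -> T).
Proof.
by split=> [x y|A]; [exact: val_inj|split=> -[V oV]; exists V].
Qed.

(** A closed set of [X] is the trace of a closed set of [Y], so a separating function on [Y]
    composed with [e] separates in [X]. *)
Lemma embedding_completely_regular (X Y : topologicalType) (e : X -> Y) :
  embedding e -> completely_regular_space Y -> completely_regular_space X.
Proof.
move=> ee crY x A cA nAx; have [_ eE] := ee.
have /eE[V oV AV] : open (~` A) by exact: closed_openC.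
have nVx : ~ (~` V) (e x) by have : (~` A) x := nAx; rewrite AV => Vx; apply.
have /(@uniform_separatorP _ R)[f [cf f01 f0 f1]] :=
  crY (e x) (~` V) (open_closedC oV) nVx.
apply/(@uniform_separatorP _ R); exists (f \o e); split.
- move=> y; apply: continuous_comp; last exact: cf.
  exact: embedding_continuous.
- by move=> _ [y _ <-]; apply: f01; exists (e y).
- by move=> _ [_ -> <-]; apply: f0; exists (e x).
- move=> _ [y Ay <-]; apply: f1; exists (e y) => // Vey.
  by have : (~` A) y by rewrite AV.
Qed.

Lemma compact_tychonoff {T : topologicalType} :
  compact [set: T] -> hausdorff_space T -> tychonoff_space T.
Proof.
move=> cT hT; split=> //; apply: (@normal_completely_regular R).
  exact: compact_normal.
exact: hausdorff_accessible.
Qed.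

Lemma connected_continuous_image (T U : topologicalType) (f : T -> U)
    (A : set T) :
  continuous f -> connected A -> connected (f @` A).
Proof.
move=> cf cA; apply: connected_continuous_connected cA _.
exact: continuous_subspaceT.
Qed.

Lemma compact_continuous_image (T U : topologicalType) (f : T -> U)
    (A : set T) :
  continuous f -> compact A -> compact (f @` A).
Proof.
by move=> cf; apply: continuous_compact; exact: continuous_subspaceT.
Qed.

(** * Contracting a closed set in a compact Hausdorff space *)

Section collapsed_theory.
Context {T : topologicalType} (P : set T).

Lemma collapse_continuous : continuous (collapse P).
Proof. by apply/continuousP => V /collapse_open. Qed.

Lemma collapse_surj (t : collapsed P) : exists x, collapse P x = t.
Proof. by exists (repr t); exact: reprK. Qed.

(** The saturation of [A] is [A] or [A] united with [P], according to whether [A] misses or meets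
    [P]. *)
Lemma collapse_closed (A : set T) :
  closed P -> closed A -> closed (collapse P @` A).
Proof.
move=> cP cA; suff : closed (collapse P @^-1` (collapse P @` A)).
  by move=> /closed_openC oA; rewrite -openC; apply/collapse_open.
have [[q [Aq Pq]]|AP] := pselect (A `&` P !=set0).
  suff -> : collapse P @^-1` (collapse P @` A) = A `|` P by exact: closedU.
  apply/seteqP; split=> [x [a Aa /collapseP[<-|[_ Px]]]|x [Ax|Px]];
    [by left|by right|by exists x|].
  by exists q => //; apply/collapseP; right.
suff -> : collapse P @^-1` (collapse P @` A) = A by [].
apply/seteqP; split=> [x [a Aa /collapseP[<-//|[Pa _]]]|x Ax]; last by exists x.
by case: AP; exists a.
Qed.

Lemma collapsed_compact : compact [set: T] -> compact [set: collapsed P].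
Proof.
move=> /(compact_continuous_image collapse_continuous).
suff -> : collapse P @` [set: T] = [set: collapsed P] by [].
by apply/seteqP; split=> // t _; have [x <-] := collapse_surj t; exists x.
Qed.

(** Two distinct fibers are disjoint closed sets, which normality of [T] separates; closedness of
    [collapse P] pushes the separation down to the quotient. *)
Lemma collapsed_hausdorff :
  compact [set: T] -> hausdorff_space T -> closed P ->
  hausdorff_space (collapsed P).
Proof.
move=> cT hT cP; rewrite open_hausdorff => s t st.
have cF (r : collapsed P) : closed (collapse P @^-1` [set r]).
  have [x xr] := collapse_surj r.
  apply: preimage_closed; first exact: in1W collapse_continuous.
  suff -> : [set r] = collapse P @` [set x].
    apply: collapse_closed => //; apply: accessible_closed_set1.
    exact: hausdorff_accessible.
  by rewrite image_set1 xr.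
have /(@normal_openP R)/(_ _ _ (cF s) (cF t))[|U [V [oU oV sU tV UV]]] :=
  compact_normal hT cT.
  by rewrite -subset0 => x [xs xt]; case/eqP: st; rewrite -xs -xt.
(* The points whose whole fiber lies in [W] form an open set of the quotient. *)
have oC W : open W -> open (~` (collapse P @` (~` W))).
  by move=> oW; rewrite openC; apply: collapse_closed => //; rewrite closedC.
exists (~` (collapse P @` (~` U)), ~` (collapse P @` (~` V))).
  by split; apply/mem_set => -[x + xE]; apply; [exact: sU|exact: tV].
split; [exact: oC|exact: oC|].
apply/eqP; rewrite -subset0 => r /= [rU rV]; have [x xr] := collapse_surj r.
suff : (U `&` V) x by rewrite UV.
split; apply: contrapT => nx; [apply: rU|apply: rV]; by exists x.
Qed.

Lemma collapse_lift (K : topologicalType) (F : T -> K) (k : K) :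
  continuous F -> (forall x, P x -> F x = k) ->
  exists2 G : collapsed P -> K, continuous G & forall x, G (collapse P x) = F x.
Proof.
move=> cF FP; exists (F \o repr) => [|x /=].
  apply: repr_comp_continuous => // x y /eqP xy; apply/eqP.
  by have /collapseP[->//|[/FP -> /FP ->]] : collapse P x = collapse P y := xy.
have /collapseP[->//|[/FP -> /FP ->//]] :
  collapse P (repr (collapse P x)) = collapse P x by exact: reprK.
Qed.

End collapsed_theory.

(** A connected neighborhood of a point of a component stays inside that component. *)
Lemma component_open (X : topologicalType) (C : set X) :
  locally_connected X -> component C -> open C.
Proof.
move=> lcX [x ->]; rewrite openE => y xy.
have [V [yV cV _]] := lcX y setT filterT.
apply: filterS (yV) => z Vz; apply: connected_component_trans xy _.
by exists V => //; split; [exact: nbhs_singleton yV|exact: subsetT|].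
Qed.

(** * The space obtained by adjoining the contracted point to [X] *)

Section adjoined_theory.
Context {X B : topologicalType} (b : X -> B) (P : set B) (p : collapsed P).
Hypotheses (B_cpt : compact [set: B]) (B_haus : hausdorff_space B).
Hypotheses (b_ext : extension b) (P_cpt : compact P).
Hypotheses (P_rem : P `<=` ~` range b) (P_p : collapse P @` P = [set p]).

Let P_closed : closed P. Proof. exact: compact_closed. Qed.

Let collapseE x : P x <-> collapse P x = p.
Proof.
have [q Pq qp] : (collapse P @` P) p by rewrite P_p.
split=> [Px|]; last by rewrite -qp => /collapseP[->|[]].
by have : (collapse P @` P) (collapse P x) by [exists x]; rewrite P_p.
Qed.

Let p_in : p \in adjoined b p. Proof. by apply/mem_set; right. Qed.

Definition adjoined_point : adjoined b p := exist _ p p_in.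

Lemma adjoined_tychonoff : tychonoff_space (adjoined b p).
Proof.
have hT := collapsed_hausdorff B_cpt B_haus P_closed.
have [crT _] := compact_tychonoff (collapsed_compact B_cpt) hT.
split; last exact: hausdorff_set_type.
exact: embedding_completely_regular (set_val_embedding _) crT.
Qed.

Lemma to_adjoined_embedding : embedding (to_adjoined b p).
Proof.
have [[bi bE] _] := b_ext; split.
  move=> x y /(congr1 set_val)/= /collapseP[/bi//|[/P_rem nx _]].
  by case: nx; exists x.
move=> A; split=> [/bE[W oW ->]|[_ [V oV <-] ->]]; last first.
  by apply/bE; exists (collapse P @^-1` V).
(* Removing [P] from [W] makes it saturated, hence the preimage of an open set of the quotient, and
   keeps its trace on [X] because [P] misses the range of [b]. *)
have cW : closed (collapse P @` (~` (W `&` ~` P))).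
  by apply: collapse_closed => //; apply/open_closedC/openI => //; rewrite openC.
exists (set_val @^-1` (~` (collapse P @` (~` (W `&` ~` P))))).
  by exists (~` (collapse P @` (~` (W `&` ~` P)))) => //; rewrite openC.
have nP x : ~ P (b x) by move=> /P_rem; apply; exists x.
apply/seteqP; split=> x /=.
  by move=> Wx [y nWy /collapseP[yx|[_ /nP//]]]; apply: nWy; rewrite yx.
by move=> nx; apply: contrapT => nW; apply: nx; exists (b x) => // -[].
Qed.

Lemma to_adjoined_rangeC : ~` range (to_adjoined b p) = [set adjoined_point].
Proof.
apply/seteqP; split=> [[t tA]|_ -> [x _]] /=.
  move=> nt; apply: val_inj => /=; have /set_mem[[x _ xt]|//] := tA.
  by case: nt; exists x => //; exact: val_inj.
by move=> /(congr1 set_val)/= /collapseE/P_rem; apply; exists x.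
Qed.

Lemma to_adjoined_dense : P !=set0 -> dense (range (to_adjoined b p)).
Proof.
move=> P0 O [t Ot] [V oV VO].
have [q qt] := collapse_surj (set_val t).
have [|y [Vy [x _ xy]]] := b_ext.2 (collapse P @^-1` V) _ oV.
  by exists q; rewrite /= qt; move: Ot; rewrite -VO.
by exists (to_adjoined b p x); split; [move: Vy; rewrite -VO -xy|exists x].
Qed.

Lemma adjoined_point_closure (C : set X) :
  P `&` closure (b @` C) !=set0 ->
  closure (to_adjoined b p @` C) adjoined_point.
Proof.
move=> [q [Pq qC]] O; rewrite nbhsE => -[_ [[V oV <-] /= Vp] VO].
have [|_ [[x Cx <-] Vx]] := qC (collapse P @^-1` V).
  by apply: open_nbhs_nbhs; split=> //=; rewrite (collapseE q).1.
by exists (to_adjoined b p x); split; [exists x|exact: VO].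
Qed.

Lemma adjoined_connected :
  (forall C : set X, component C -> P `&` closure (b @` C) !=set0) ->
  connected [set: adjoined b p].
Proof.
move=> PC; pose E x := closure (to_adjoined b p @` connected_component setT x).
have Ep x : E x adjoined_point by apply/adjoined_point_closure/PC; exists x.
(* The connected sets through the adjoined point cover the space: a point of [X] lies in the closure
   of its component, and the singleton covers the adjoined point itself. *)
have sE : [set: adjoined b p] `<=`
    \bigcup_(A in [set A | A adjoined_point /\ connected A]) A.
  move=> t _; have [[x _ xt]|nt] := pselect (range (to_adjoined b p) t).
    exists (E x); last first.
      apply: subset_closure; exists x => //.
      exact: connected_component_refl.
    split; first exact: Ep.
    apply/connected_closure/connected_continuous_image.
      exact: embedding_continuous to_adjoined_embedding.
    exact: component_connected.
  have : (~` range (to_adjoined b p)) t by [].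
  rewrite to_adjoined_rangeC => ->; exists [set adjoined_point] => //.
  by split=> //; exact: connected1.
have -> : [set: adjoined b p] =
    \bigcup_(A in [set A | A adjoined_point /\ connected A]) A.
  exact/seteqP.
by apply: bigcup_connected => [|A []//]; exists adjoined_point => A [].
Qed.

End adjoined_theory.

(* A point [q] outside the image of [b] and a point [b x] have disjoint
   neighborhoods; since [f] is an embedding, the trace on [X] of the one of
   [b x] is also a neighborhood of [f x], so [F q = f x] would contradict
   the density of [range b]. *)
Lemma extension_fiber (X B K : topologicalType) (b : X -> B) (f : X -> K)
    (F : B -> K) (q : B) (x : X) :
  hausdorff_space B -> extension b -> embedding f -> continuous F ->
  (forall x, F (b x) = f x) -> F q = f x -> q = b x.
Proof.
move=> hB [eb db] [_ fE] cF Fb Fq; apply: hB => U V.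
rewrite !nbhsE => -[U' [oU U'q] UU'] [V' [oV V'x] VV'].
have /fE[W oW VW] : open (b @^-1` V').
  by apply: open_comp => //; exact: in1W (embedding_continuous eb).
have [||y [[U'y Wy] [z _ zy]]] := db (U' `&` F @^-1` W).
- by exists q; split=> //=; rewrite Fq; have : (b @^-1` V') x by []; rewrite VW.
- by apply: openI => //; apply: open_comp => //; exact: in1W cF.
exists (b z); split; first by apply: UU'; rewrite zy.
by apply: VV'; suff : (b @^-1` V') z by []; rewrite VW /preimage /= -Fb zy.
Qed.

(** * Components of [X] inside a connectification *)

Lemma connectification_component_closure (X Y : topologicalType) (e : X -> Y)
    (p : Y) (C : set X) :
  locally_connected X -> hausdorff_space Y -> embedding e ->
  ~` range e = [set p] -> connected [set: Y] -> component C ->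
  closure (e @` C) p.
Proof.
move=> lcX hY [ei eE] ep cY compC; apply: contrapT => np.
have clp : closed [set p].
  exact/accessible_closed_set1/hausdorff_accessible.
have reE y : range e y \/ y = p.
  have [|nr] := pselect (range e y); [by left|right].
  by have : (~` range e) y := nr; rewrite ep.
have nep x : e x <> p.
  by move=> xp; have : (~` range e) p by [rewrite ep]; apply; exists x.
have oC : open (e @` C).
  have /eE[V oV CV] := component_open lcX compC.
  suff -> : e @` C = V `&` ~` [set p] by apply: openI => //; rewrite openC.
  rewrite CV; apply/seteqP; split=> [_ [x Vx <-]|y [Vy yp]].
    by split=> //; exact: nep.
  by have [[x _ xy]|//] := reE y; exists x; rewrite //= xy.
have cC : closed (e @` C).
  have /eE[V oV CV] : open (~` C).
    by rewrite openC; have [x ->] := compC; exact/component_closed/closedT.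
  move=> y; have [[x _ <-]|->//] := reE y.
  move=> clx; have [Cx|nCx] := pselect (C x); first by exists x.
  have Vx : (e @^-1` V) x by rewrite -CV.
  have [_ [[z Cz <-] Vz]] := clx V (open_nbhs_nbhs (conj oV Vx)).
  by have : (~` C) z by rewrite CV.
have CT : e @` C = setT.
  apply: cY; [|by exists (e @` C); rewrite ?setTI..].
  have [x ->] := compC; exists (e x); exists x => //.
  exact: connected_component_refl.
by apply: np; apply: subset_closure; rewrite CT.
Qed.

Theorem theorem2p5 (X B : topologicalType) (b : X -> B)
    (X_lc : locally_connected X) (X_tych : tychonoff_space X)
    (X_ncpt : forall C : set X, component C -> ~ compact C)
    (b_sc : stone_cech b) :
  (forall (P : set B) (p : collapsed P),
     P !=set0 -> compact P -> P `<=` ~` range b ->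
     (forall C : set X, component C -> P `&` closure (b @` C) !=set0) ->
     collapse P @` P = [set p] ->
     tychonoff_space (adjoined b p) /\
     one_point_connectification (to_adjoined b p)) /\
  (forall (Y : topologicalType) (e : X -> Y),
     tychonoff_space Y -> one_point_connectification e ->
     exists (P : set B) (p : collapsed P),
       [/\ P !=set0, compact P, P `<=` ~` range b,
           (forall C : set X, component C -> P `&` closure (b @` C) !=set0) &
           collapse P @` P = [set p] /\
           exists2 h : Y -> adjoined b p,
             homeomorphism h & forall x, h (e x) = to_adjoined b p x]).
Proof.
have [cB hB eb ub] := b_sc; split.
  move=> P p P0 cP Pb PC Pp; split.
    exact: adjoined_tychonoff.
  split; last exact: adjoined_connected.
  split; last by exists (adjoined_point b p); exact: to_adjoined_rangeC.
  by split; [exact: to_adjoined_embedding|exact: to_adjoined_dense].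

(* Recovering the contracted set from a connectification *)
move=> Y e tY [[[ee de] [y0 ey0]] cY].
have [K [k [cK hK [ek _] _]]] := stone_cech_exists R tY.
have eke := embedding_comp ee ek.
have [F cF Fb] := ub K (k \o e) cK hK (embedding_continuous eke).
have fiber q x : F q = k (e x) -> q = b x.
  exact: (@extension_fiber X B K b (k \o e)).
have cFA A : closed A -> closed (F @` A).
  move=> clA; apply: compact_closed => //; apply: compact_continuous_image => //.
  exact: subclosed_compact cB _.
have ney x : e x <> y0.
  by move=> xy; have : (~` range e) y0 by [rewrite ey0]; apply; exists x.
have reE y : range e y \/ y = y0.
  have [|nr] := pselect (range e y); [by left|right].
  by have : (~` range e) y := nr; rewrite ey0.
(* The image under [F] of the closure of [b @] C[is closed and contains]k (e
   x)[for every]x[in]C[, so it contains]k y[for each limit point]y[of]e @[C]. *)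
have FC (C : set X) y : closure (e @` C) y ->
    exists2 q, closure (b @` C) q & F q = k y.
  move=> Cy; suff : (F @` closure (b @` C)) (k y) by [].
  have /closure_id -> := cFA _ (@closed_closure _ (b @` C)).
  move=> U kU.
  have [_ [[x Cx <-] Ux]] := Cy (k @^-1` U) (embedding_continuous ek kU).
  exists (k (e x)); split=> //; exists (b x) => //.
  by apply: subset_closure; exists x.
pose P := F @^-1` [set k y0].
(* Density of [e] puts [y0] in the closure of the image of all of [X], so [FC] provides a preimage
   of [k y0]. *)
have [q0 Pq0] : P !=set0.
  have [|q _ Fq] := FC setT y0; last by exists q.
  move=> U; rewrite nbhsE => -[V [oV Vy] VU].
  have [z [Vz rz]] := de V (ex_intro _ y0 Vy) oV.
  by exists z; split=> //; exact: VU.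
have clP : closed P.
  apply: preimage_closed; first exact: in1W cF.
  exact/accessible_closed_set1/hausdorff_accessible.
have Pb : P `<=` ~` range b.
  by move=> _ /[swap] -[x _ <-]; rewrite /P /= Fb /= => /ek.1/ney.
exists P, (collapse P q0).
have Pp : collapse P @` P = [set collapse P q0].
  apply/seteqP; split=> [_ [q Pq <-]|_ ->]; last by exists q0.
  by apply/collapseP; right.
split=> //.
- by exists q0.
- exact: (subclosed_compact clP cB (@subsetT _ P)).
- move=> C compC.
  have [|q clq Fq] := FC C y0; last by exists q.
  exact: connectification_component_closure tY.2 ee ey0 cY compC.
split=> //.
have [G cG GF] := @collapse_lift _ P K F (k y0) cF (fun _ Px => Px).
have GA (t : adjoined b (collapse P q0)) : exists y, k y = G (set_val t).
  have : adjoined b (collapse P q0) (set_val t) := set_valP t.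
  move=> [[x _ <-]|->]; first by exists (e x); rewrite GF Fb.
  by exists y0; rewrite GF Pq0.
(* Over a point of [X] the fiber of [F] is a single point by [fiber]; over [k y0] it is [P], a
   single class. *)
have Gi (t : adjoined b (collapse P q0)) (q : B) :
    F q = G (set_val t) -> collapse P q = set_val t.
  have : adjoined b (collapse P q0) (set_val t) := set_valP t.
  move=> [[x _ <-]|->]; rewrite GF.
    by rewrite Fb => /fiber ->.
  by move=> Fq; apply/collapseP; right; rewrite /P /= Fq.
have AY y : exists t : adjoined b (collapse P q0), G (set_val t) = k y.
  have [[x _ <-]|->] := reE y.
    by exists (to_adjoined b (collapse P q0) x); rewrite /= GF Fb.
  by exists (adjoined_point b (collapse P q0)); rewrite /= GF.
have [g gE] := choice GA; have [h hE] := choice AY.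
have hi (t u : adjoined b (collapse P q0)) :
    G (set_val t) = G (set_val u) -> t = u.
  have [q qt] := collapse_surj (set_val t).
  by rewrite -{1}qt GF => /Gi; rewrite qt => /val_inj.
exists h; last by move=> x; apply: hi; rewrite hE /= GF Fb.
split.
  apply/continuousP => _ [V oV <-].
  (* [W] consists of the points whose whole [F]-fiber is sent into [V]. The fiber over [k y] is sent
     to the single point [h y], so [k y] lies in [W] exactly when [h y] lies in [V]. *)
  pose W := ~` (F @` (~` (collapse P @^-1` V))).
  have oW : open W by rewrite openC; apply: cFA; apply: open_closedC.
  apply/ek.2; exists W => //.
  apply/seteqP; split=> y /=.
    by move=> Vy [q nVq]; rewrite -hE => /Gi qE; apply: nVq; rewrite /= qE.
  have [q qt] := collapse_surj (set_val (h y)).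
  move=> nF; apply: contrapT => nV; apply: nF; exists q.
    by rewrite /= qt.
  by rewrite -hE -qt GF.
exists g; split.
(* As [k] is an embedding and [k (g t) = G (set_val t)], continuity of [g] reduces to that of
   [G]. *)
- apply/continuousP => V /ek.2[W oW ->].
  exists (G @^-1` W); first by apply: open_comp => //; exact: in1W cG.
  by apply/seteqP; split=> t /=; rewrite gE.
- by move=> y; apply: ek.1; rewrite gE hE.
- by move=> t; apply: hi; rewrite hE gE.
Qed.
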